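(* For integers $k\ge1$ and $\ell>-k$, $$a_{k,k+\ell}=\begin{cases} F_{\ell+2}+1, & \text{if } k=1,\ \ell\ge0,\\[2pt] 2\sum_{i=0}^{k-2}\binom{\ell}{i}F_{k-i}+2\binom{\ell}{k-1}+\sum_{j=1}^{\ell}\binom{j}{\ell-j+k}, & \text{if } k\ge2,\ \ell\ge0,\\[2pt] F_{k+\ell+1}, & \text{if } k\ge2,\ -k<\ell<0.\end{cases}$$
   Context: $\mathbb{N}=\{1,2,3,\dots\}$, and $\mathcal{N}$ denotes the collection of finite subsets of $\mathbb{N}$. For $E\in\mathcal{N}$ and $k\in\mathbb{N}$, let $\omega_k(E)=\sum_{i\in E,\, i\neq k}1$. For $k,n\in\mathbb{N}$, let $\mathcal{A}_{k,n}=\{E\in\mathcal{N} : E=\emptyset \text{ or } \omega_k(E)<\min E\le \max E\le n\}$ and $a_{k,n}=|\mathcal{A}_{k,n}|$. $(F_n)_{n\ge0}$ is the Fibonacci sequence: $F_0=0$, $F_1=1$, $F_n=F_{n-1}+F_{n-2}$ for $n\ge2$. Binomial coefficients $\binom{a}{b}$ with integers $a\ge 0$, $b\ge0$ and $b>a$ are $0$. *)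

(* Defs.v *)
From mathcomp Require Export all_boot all_order all_algebra finmap.
From mathcomp Require Export mathcomp_extra boolp classical_sets functions.
From mathcomp Require Export cardinality.

Set Implicit Arguments.
Unset Strict Implicit.
Unset Printing Implicit Defensive.

Local Open Scope nat_scope.
Local Open Scope fset_scope.
Local Open Scope classical_set_scope.

(* The natural numbers are {1, 2, 3, ...} here: a finite set of them is an
   {fset nat} that does not contain 0. *)
Definition finsets : set {fset nat} := [set E : {fset nat} | 0 \notin E].

Definition omega (k : nat) (E : {fset nat}) : nat := \sum_(i <- E | i != k) 1.

Definition fmax (E : {fset nat}) : nat := \max_(i <- E) i.

(* The initial value fmax E leaves the minimum of a nonempty E unchanged;
   fmin and fmax are only used on nonempty sets. *)
Definition fmin (E : {fset nat}) : nat := \big[minn/fmax E]_(i <- E) i.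

Definition calA (k n : nat) : set {fset nat} :=
  [set E | finsets E /\ (E = fset0 \/ omega k E < fmin E <= fmax E /\ fmax E <= n)].

(* fset_set is the empty set on infinite arguments, so the definition of acard
   below relies on this lemma. *)
Lemma finite_calA (k n : nat) : finite_set (calA k n).
Proof.
apply: (@sub_finite_set _ _ [set` fpowerset [fset j in iota 0 n.+1]]);
  last exact: finite_fset.
move=> E [_ AE] /=; rewrite fpowersetE; apply/fsubsetP => i iE.
rewrite in_fset (mem_iota 0 n.+1) add0n ltnS /=.
case: AE => [E0 | [_ maxE]]; first by rewrite E0 in_fset0 in iE.
by apply: leq_trans maxE; rewrite /fmax (big_rem i iE) /= leq_maxl.
Qed.

Definition acard (k n : nat) : nat := #|` fset_set (calA k n)|.

Fixpoint fib (n : nat) : nat :=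
  match n with
  | 0 => 0
  | 1 => 1
  | (m.+1 as p).+1 => fib p + fib m
  end.

(* Main.v *)
(* A set in A_{k,n} is determined by its s = omega_k elements other than k, which
   all exceed s, and by whether it contains k. If s < k <= n there are
   C(n-s-1, s) choices for the former and 2 for the latter; otherwise k is
   excluded and there are C(n-s, s) choices. The sum over s < k of
   C(k+l-1-s, s) equals the sum over i < k of C(l, i) F_{k-i}: by Pascal's rule
   both satisfy x(k, l+1) = x(k, l) + x(k-1, l), and both are F_k at l = 0. *)
Require Import Defs.
From mathcomp Require Import fintype finset zify.
Import Order.TTheory GRing.Theory Num.Theory.

Local Open Scope nat_scope.

(** * Reduction to subsets of an ordinal type *)

Lemma fmin_le (E : {fset nat}) (i : nat) : i \in E -> fmin E <= i.
Proof.
rewrite /fmin -[i \in E]/(i \in enum_fset E); move: (fmax E) => m; elim: (enum_fset E) => // x s IH.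
rewrite in_cons big_cons geq_min => /predU1P[->|/IH ->]; first by rewrite leqnn.
by rewrite orbT.
Qed.

Lemma le_fmax (E : {fset nat}) (i : nat) : i \in E -> i <= fmax E.
Proof. by move=> iE; rewrite /fmax (big_rem i iE) /= leq_maxl. Qed.

(** The bound holds vacuously on the empty set, so it absorbs that alternative; being strict below,
    it also keeps 0 out of [E]. *)
Lemma calAP (k n : nat) (E : {fset nat}) :
  calA k n E <-> forall i, i \in E -> omega k E < i <= n.
Proof.
split=> [[_ [-> i|[/andP[lt_om _] le_n] i iE]]|bE].
- by rewrite in_fset0.
- by rewrite (leq_trans lt_om) ?fmin_le // (leq_trans (le_fmax _ _ iE)).
split; first by apply/negP => /bE.
have [->|/fset0Pn [x xE]] := eqVneq E fset0; first by left.
right; split; last first.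
  by rewrite /fmax; apply/bigmax_leqP_seq => i iE _; case/andP: (bE _ iE).
rewrite (leq_trans (fmin_le _ _ xE) (le_fmax _ _ xE)) andbT.
(* The first case is the initial value [fmax E], handled through the element [x]. *)
rewrite /fmin big_seq; elim/big_ind: _ => [|a b lt_a lt_b|i iE].
- by apply: leq_trans (le_fmax _ _ xE); case/andP: (bE _ xE).
- by rewrite leq_min lt_a.
- by case/andP: (bE _ iE).
Qed.

(** The sets of [calAP] inside a finite type: the upper bound [n] is carried by ['I_n.+1]. *)
Definition schreier (k n : nat) : {set {set 'I_n.+1}} :=
  [set A : {set 'I_n.+1} |
    A \subset [set i : 'I_n.+1 | #|[set j in A | j != k :> nat]| < i]].

Lemma acardE (k n : nat) : acard k n = #|schreier k n|.
Proof.
pose f (A : {set 'I_n.+1}) : {fset nat} := seq_fset tt (map val (enum A)).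
have memf A (i : 'I_n.+1) : (val i \in f A) = (i \in A).
  by rewrite seq_fsetE mem_map ?mem_enum //; exact: val_inj.
have f_inj : injective f.
  by move=> A B eqAB; apply/setP => i; rewrite -!memf eqAB.
have omf A : omega k (f A) = #|[set j in A | j != k :> nat]|.
  rewrite /omega -sum1dep_card.
  rewrite (perm_big (map val (enum A))); last first.
    apply: uniq_perm; first exact: (fset_uniq (f A)).
      by rewrite map_inj_uniq ?enum_uniq //; exact: val_inj.
    exact: seq_fsetE.
  by rewrite big_map big_enum_cond.
rewrite cardE -(size_map f) /acard.
apply/perm_size/uniq_perm; rewrite ?fset_uniq //.
  by rewrite map_inj_uniq ?enum_uniq.
move=> E; rewrite (in_fset_set (finite_calA k n)).
apply/idP/mapP => [/set_mem/calAP bE|[A + ->]].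
- have EfA : E = f [set i : 'I_n.+1 | val i \in E].
    apply/fsetP => x; rewrite seq_fsetE; apply/idP/mapP => [xE|[i + ->]].
      have /andP[_ le_xn] := bE _ xE.
      by exists (Ordinal (le_xn : x < n.+1)); rewrite ?mem_enum ?inE.
    by rewrite mem_enum inE.
  exists [set i : 'I_n.+1 | val i \in E] => //.
  rewrite mem_enum inE; apply/subsetP => i; rewrite !inE => /bE /andP[+ _].
  by rewrite [in omega k E]EfA omf.
- rewrite mem_enum inE => /subsetP sA; apply/mem_set/calAP => x.
  rewrite seq_fsetE => /mapP[i]; rewrite mem_enum => /sA.
  by rewrite inE omf => lt_i ->; rewrite lt_i -ltnS ltn_ord.
Qed.

(** * Counting by the number of elements other than [k] *)

Lemma card_ord_gt (n s : nat) : #|[set i : 'I_n.+1 | s < i]| = n - s.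
Proof.
rewrite -sum1dep_card -(big_mkord (fun i => s < i) (fun _ => 1)).
have [le_sn|lt_ns] := leqP s n; last first.
  by rewrite big_nat_cond big1 => [|i]; lia.
rewrite (big_cat_nat (n := s.+1)) //= big_nat_cond big1 ?add0n => [|i]; last lia.
rewrite big_nat_cond (eq_bigl (fun i => (s.+1 <= i < n.+1) && true)) => [|i]; last by lia.
by rewrite -big_nat_cond sum_nat_const_nat muln1.
Qed.

Lemma card_schreier_fiber (k n s : nat) :
  #|[set A in schreier k n | #|[set j in A | j != k :> nat]| == s]| =
  if s < k <= n then 2 * 'C(n - s.+1, s) else 'C(n - s, s).
Proof.
pose G := [set i : 'I_n.+1 | s < i].
have fiberE (A : {set 'I_n.+1}) :
    (A \in [set A in schreier k n | #|[set j in A | j != k :> nat]| == s]) =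
    (A \subset G) && (#|[set j in A | j != k :> nat]| == s).
  rewrite !inE; case: eqP => [->|_]; rewrite ?andbF //.
(* If [k <= s] or [k > n], no set of the fiber contains [k], so the count [s] is the full
   cardinality. *)
case: ifP => [/andP[lt_sk le_kn]|kNG]; last first.
  rewrite -(card_ord_gt n s) -cards_draws; apply: eq_card => A.
  rewrite fiberE inE; apply: andb_id2l => /subsetP sAG; congr (_ == _).
  apply: eq_card => i; rewrite !inE andb_idr // => /sAG; rewrite inE.
  by apply: contraTneq => ik; have := ltn_ord i; lia.
pose k' := Ordinal (le_kn : k < n.+1).
(* [D] collects the sets of the fiber that omit [k]. *)
have neqk (i : 'I_n.+1) : (i != k :> nat) = (i != k') by [].
pose D := [set B : {set 'I_n.+1} | B \subset G :\ k' & #|B| == s].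
have kG : k' \in G by rewrite inE.
have cardD : #|D| = 'C(n - s.+1, s).
  rewrite /D cards_draws; congr 'C(_, s).
  by have := cardsD1 k' G; rewrite card_ord_gt kG subnS => ->.
have kND B : B \in D -> k' \notin B.
  rewrite inE => /andP[/subsetP sB _]; apply/negP => /sB.
  by rewrite !inE eqxx.
have others (A : {set 'I_n.+1}) : [set j in A | j != k :> nat] = A :\ k'.
  by apply/setP => i; rewrite !inE neqk andbC.
(* Adding [k] to the sets of [D] gives those that contain it, since [s < k] makes [k] admissible and
   [k] does not count towards [s]. *)
have -> : [set A in schreier k n | #|[set j in A | j != k :> nat]| == s] =
          D :|: [set k' |: B | B in D].
  apply/setP => A; rewrite fiberE others inE.
  apply/idP/orP => [/andP[sAG cA]|[AD|/imsetP[B BD ->]]].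
  - have AD : A :\ k' \in D by rewrite inE setSD.
    have [kA|kNA] := boolP (k' \in A); [right|left].
      by apply/imsetP; exists (A :\ k') => //; rewrite setD1K.
    suff -> : A = A :\ k' by [].
    by apply/setP => i; rewrite !inE andb_idl // => iA; apply: contraNneq kNA => <-.
  - rewrite setDE (setIidPl _); last first.
      by rewrite subsetC sub1set inE kND.
    by move: AD; rewrite inE subsetD1 -andbA => /and3P[-> _ ->].
  - rewrite setU1K ?kND //; move: BD; rewrite inE subsetD1 => /andP[/andP[sB _] ->].
    by rewrite subUset sub1set kG sB.
rewrite cardsU card_in_imset => [|B C BD CD /(congr1 (fun A => A :\ k'))];
  last by rewrite !setU1K ?kND.
rewrite cardD (_ : _ :&: _ = set0) ?cards0 ?subn0 ?mul2n ?addnn //.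
apply/setP => A; rewrite !inE; apply/negP => /andP[AD /imsetP[B _ AB]].
by have := kND A; rewrite inE AD => /(_ isT); rewrite AB setU11.
Qed.

Lemma acard_sum (k n : nat) : acard k n =
  \sum_(0 <= s < n.+1) if s < k <= n then 2 * 'C(n - s.+1, s) else 'C(n - s, s).
Proof.
rewrite acardE -sum1_card big_mkord.
pose c (A : {set 'I_n.+1}) := #|[set j in A | j != k :> nat]|.
have lt_c (A : {set 'I_n.+1}) : A \in schreier k n -> c A < n.+1.
  rewrite inE -/(c A) => /subsetP sA.
  have [A0|[x xA]] := set_0Vmem A; last first.
    by have := sA _ xA; rewrite inE => /ltn_trans; apply.
  by rewrite /c A0 (_ : [set _ in _ | _] = set0) ?cards0 //;
    apply/setP => i; rewrite !inE.
(* [inord] makes the count an index in a finite type; [lt_c] ensures that it does not alter the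
   value. *)
rewrite (partition_big (fun A => inord (c A) : 'I_n.+1) predT) //=.
apply: eq_bigr => s _; rewrite -card_schreier_fiber -sum1dep_card.
apply: eq_bigl => A; apply: andb_id2l => AS.
by rewrite -val_eqE /= inordK ?lt_c.
Qed.

(** * Diagonal sums of binomial coefficients *)

Lemma sum_bin_shift (k l : nat) :
  \sum_(0 <= s < k.+1) 'C(k.+1 + l.+1 - s.+1, s) =
  \sum_(0 <= s < k.+1) 'C(k.+1 + l - s.+1, s) +
  \sum_(0 <= s < k) 'C(k + l - s.+1, s).
Proof.
rewrite big_nat_recl // [in RHS]big_nat_recl // !bin0 -addnA; congr addn.
rewrite -big_split /=; apply: eq_big_nat => s /andP[_ lt_sk].
(* Since [s < k], no subtraction truncates, and Pascal's rule applies termwise. *)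
by rewrite (_ : k.+1 + l.+1 - s.+2 = (k.+1 + l - s.+2).+1) ?binS;
  [congr ('C(_, _) + 'C(_, _)); lia|lia].
Qed.

Lemma sum_bin_fib (k : nat) : \sum_(0 <= s < k) 'C(k - s.+1, s) = fib k.
Proof.
(* Two consecutive values are carried along to match the two-step recursion of [fib]. *)
suff: \sum_(0 <= s < k) 'C(k - s.+1, s) = fib k /\
      \sum_(0 <= s < k.+1) 'C(k.+1 - s.+1, s) = fib k.+1 by case.
elim: k => [|k [IH0 IH1]]; first by rewrite big_nat1 big_geq.
split=> //; rewrite (_ : fib k.+2 = fib k.+1 + fib k) // -IH1 -IH0.
(* The last term is ['C(0, k.+1)], which vanishes; the rest is the shift identity at [l = 0]. *)
rewrite big_nat_recr //= subnn bin_small // addn0.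
have := sum_bin_shift k 0; rewrite !addn0 addn1 => <-.
by apply: eq_bigr => s _; congr 'C(_, _); lia.
Qed.

Lemma sum_bin_bin_fib (k l : nat) :
  \sum_(0 <= s < k) 'C(k + l - s.+1, s) =
  \sum_(0 <= i < k) 'C(l, i) * fib (k - i).
Proof.
elim: l k => [|l IH] [|k]; [by rewrite !big_geq| |by rewrite !big_geq|].
  under eq_bigr do rewrite addn0.
  rewrite sum_bin_fib big_nat_recl //= mul1n big1 ?addn0 //.
rewrite sum_bin_shift !IH big_nat_recl // [RHS]big_nat_recl // !bin0 -addnA.
congr addn; rewrite -big_split /=; apply: eq_bigr => i _.
by rewrite binS mulnDl subSS.
Qed.

(** * Evaluation of the count *)

Lemma acard_lt (k n : nat) : n < k -> acard k n = fib n.+1.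
Proof.
move=> lt_nk; rewrite acard_sum -sum_bin_fib; apply: eq_bigr => s _.
by rewrite (leqNgt k) lt_nk andbF subSS.
Qed.

Lemma acard_ge (k l : nat) : acard k (k + l) =
  2 * (\sum_(0 <= s < k) 'C(k + l - s.+1, s)) +
  \sum_(k <= s < (k + l).+1) 'C(k + l - s, s).
Proof.
rewrite acard_sum (big_cat_nat (n := k)) //=; last by lia.
rewrite big_distrr /=; congr addn; apply: eq_big_nat => s bs;
  case: ifP => //; lia.
Qed.

Lemma sum_bin_tail (k l : nat) : 0 < k ->
  \sum_(k <= s < (k + l).+1) 'C(k + l - s, s) =
  \sum_(1 <= j < l.+1) 'C(j, l - j + k).
Proof.
(* Substitute [j = k + l - s]. *)
move=> k_gt0; rewrite big_nat_rev /= -{1}[k]add0n big_addn.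
rewrite (_ : (k + l).+1 - k = l.+1); last by lia.
(* The extra term [j = 0] is ['C(0, l + k)], zero because [k > 0]. *)
have -> : \sum_(1 <= j < l.+1) 'C(j, l - j + k) =
          \sum_(0 <= j < l.+1) 'C(j, l - j + k).
  by rewrite [RHS]big_ltn // bin_small ?add0n //; lia.
apply: eq_big_nat => j bj; congr 'C(_, _); lia.
Qed.

Theorem theorem1p2 (k : nat) (l : int) (hk : 1 <= k) (hl : (- k%:Z < l)%R) :
  [/\ k = 1 -> (0 <= l)%R ->
        acard k `|(k%:Z + l)%R| = fib `|(l + 2)%R| + 1,
      2 <= k -> (0 <= l)%R ->
        acard k `|(k%:Z + l)%R| =
          2 * (\sum_(0 <= i < k.-1) 'C(`|l|, i) * fib (k - i))
          + 2 * 'C(`|l|, k.-1)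
          + \sum_(1 <= j < `|l|.+1) 'C(j, `|l| - j + k)
    & 2 <= k -> (l < 0)%R ->
        acard k `|(k%:Z + l)%R| = fib `|(k%:Z + l + 1)%R| ].
Proof.
split=> [-> l_ge0|k_ge2 l_ge0|k_ge2 l_lt0].
- rewrite (_ : `|(1%:Z + l)%R| = 1 + `|l|); last by lia.
  rewrite (_ : `|(l + 2)%R| = `|l|.+2); last by lia.
  (* The term [s = 0] contributes 2, while the tail is the diagonal sum for [fib] at [l + 2] without
     its first term 1. *)
  rewrite acard_ge big_nat1 bin0 -sum_bin_fib [in RHS]big_ltn // bin0.
  by rewrite add1n; under [in RHS]eq_bigr do rewrite subSS; lia.
- rewrite (_ : `|(k%:Z + l)%R| = k + `|l|); last by lia.
  rewrite acard_ge sum_bin_tail // sum_bin_bin_fib -mulnDr.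
  case: k {hl} hk k_ge2 => // k _ _.
  (* The top term of the sum carries [fib 1 = 1] and becomes the separate binomial. *)
  by rewrite big_nat_recr //= subSnn muln1.
- rewrite acard_lt; last by lia.
  by congr fib; lia.
Qed.
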